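(* For $k=1,\dots,K$ let $v_k$ with $0\le v_k\le 1$ satisfy $v_k\sum_{i=1}^{n_k}\|M^{k(i)}\|_2\|N_{k(i)}\|_2=\|M^kN_k\|_F$, and assume $\theta_1\le 1-v_k^2\le\theta_2$ for all $k$, where $0\le\theta_1\le\theta_2\le 1$. Let $0<\beta\le1$ and $\hat\varphi=(1-\beta(1-\theta_2))^{1/2}$. Let $\hat C,\hat D$ be the matrices $C,D$ produced by the block sampling algorithm (see context) with sampling probabilities satisfying $$p_{k_i}\ge\frac{\beta\|M^{k(i)}\|_2\|N_{k(i)}\|_2}{\sum_{i'=1}^{n_k}\|M^{k(i')}\|_2\|N_{k(i')}\|_2},\qquad k=1,\dots,K,\ i=1,\dots,n_k,$$ and with sampling block sizes $$c_k=\hat c_k=c\,\frac{\sum_{i=1}^{n_k}\|M^{k(i)}\|_2\|N_{k(i)}\|_2}{\sum_{l=1}^{K}\sum_{i=1}^{n_l}\|M^{l(i)}\|_2\|N_{l(i)}\|_2},\qquad k=1,\dots,K.$$ Then $$\sum_{h=1}^{m}\sum_{f=1}^{p}\sigma_{h,f}^2\le\frac{\hat\varphi^2}{\beta c}\|M\|_F^2\|N\|_F^2,$$ and, for $\delta\in(0,1)$ and $\eta=\hat\varphi+\sqrt{(8/\beta)\log(1/\delta)}$, the inequality $$\|MN-\hat C\hat D\|_F^2\le\frac{\eta^2}{\beta c}\|M\|_F^2\|N\|_F^2$$ holds with probability at least $1-\delta$.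
   Context: $M\in\mathbb{R}^{m\times n}$ and $N\in\mathbb{R}^{n\times p}$ are partitioned conformally as $M=[M^1\ \cdots\ M^K]$ with $M^k\in\mathbb{R}^{m\times n_k}$ and $N^T=[N_1^T\ \cdots\ N_K^T]$ with $N_k\in\mathbb{R}^{n_k\times p}$, $\sum_{k=1}^K n_k=n$. $M^{k(i)}$ is the $i$-th column of $M^k$, $N_{k(i)}$ the $i$-th row of $N_k$, $M^k_{(h,i)}$ and $N_{k(i,f)}$ the corresponding entries. $\|\cdot\|_2$ is the Euclidean norm, $\|\cdot\|_F$ the Frobenius norm. Block sampling algorithm. Input: the matrices $M=[M^1\ \cdots\ M^K]\in\mathbb{R}^{m\times n}$ and $N\in\mathbb{R}^{n\times p}$ with $N^T=[N_1^T\ \cdots\ N_K^T]$, where $M^k\in\mathbb{R}^{m\times n_k}$, $N_k\in\mathbb{R}^{n_k\times p}$ and $\sum_{k=1}^K n_k=n$, positive integers $c_1,\dots,c_K$ with $1\le c_k\le n_k$ and $\sum_k c_k=c$, and probabilities $p_{k_i}\ge0$ with $\sum_{i=1}^{n_k}p_{k_i}=1$ for each $k$. For each block $k$, independently across blocks, draw $i_1,\dots,i_{c_k}\in\{1,\dots,n_k\}$ independently with replacement with $\Pr(i_t=s)=p_{k_s}$; let $C^k\in\mathbb{R}^{m\times c_k}$ have $t$-th column $M^{k(i_t)}/\sqrt{c_kp_{k_{i_t}}}$ and $D_k\in\mathbb{R}^{c_k\times p}$ have $t$-th row $N_{k(i_t)}/\sqrt{c_kp_{k_{i_t}}}$. Output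 $C=[C^1\ \cdots\ C^K]$, $D^T=[D_1^T\ \cdots\ D_K^T]$, and $CD=\sum_{k=1}^{K}C^kD_k$. The asymptotic variance of the $(h,f)$ entry is $$\sigma_{h,f}^2=\sum_{k=1}^{K}\sum_{i=1}^{n_k}\frac{(M^k_{(h,i)})^2(N_{k(i,f)})^2}{c_kp_{k_i}}-\sum_{k=1}^{K}\frac{((M^kN_k)_{(h,f)})^2}{c_k},$$ with terms $0/0$ read as $0$. The prescribed $\hat c_k$ are assumed to be admissible inputs (positive integers with $\hat c_k\le n_k$), and all denominators in the formulas are assumed nonzero. *)

(* Defs.v *)
From mathcomp Require Import all_boot all_order all_algebra.
From mathcomp Require Import all_classical all_reals all_analysis.

Set Implicit Arguments.
Unset Strict Implicit.
Unset Printing Implicit Defensive.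

Import Order.TTheory GRing.Theory Num.Theory.

Local Open Scope ring_scope.

(* The norm of the library on matrices is the sup norm.  On a matrix with a
   single row or column, [normF] is the Euclidean norm. *)
Definition normF (R : realType) (m n : nat) (A : 'M[R]_(m, n)) : R :=
  Num.sqrt (\sum_i \sum_j A i j ^+ 2).

Section BlockSampling.
Variables (R : realType) (m p K : nat) (n : 'I_K -> nat).
Variables (M : 'M[R]_(m, \sum_k n k)) (N : 'M[R]_(\sum_k n k, p)).
Variables (c : 'I_K -> nat) (pr : forall k, 'I_(n k) -> R).

Definition Mblock (k : 'I_K) : 'M[R]_(m, n k) := submxrow M k.
Definition Nblock (k : 'I_K) : 'M[R]_(n k, p) := submxcol N k.

Definition block_weight (k : 'I_K) : R :=
  \sum_(i < n k) normF (col i (Mblock k)) * normF (row i (Nblock k)).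

(* An outcome [w] records all the draws: [w k t] is the index drawn at the
   [t]-th trial in block [k]. *)
Definition draws : finType :=
  {dffun forall k : 'I_K, {ffun 'I_(c k) -> 'I_(n k)}}.

(* All draws are independent, within a block and across blocks, so their joint
   law is the product of the laws [pr k]. *)
Definition draws_mass (w : draws) : R :=
  \prod_(k < K) \prod_(t < c k) pr (w k t).

Definition draws_prob (E : {set draws}) : R := \sum_(w in E) draws_mass w.

(* If [pr i = 0] the inverse below is the junk value [0]; such an index is
   drawn with probability [0]. *)
Definition sample_scale (k : 'I_K) (i : 'I_(n k)) : R :=
  (Num.sqrt ((c k)%:R * pr i))^-1.

Definition Cblock (w : draws) (k : 'I_K) : 'M[R]_(m, c k) :=
  \matrix_(h, t) (sample_scale (w k t) * Mblock k h (w k t)).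

Definition Dblock (w : draws) (k : 'I_K) : 'M[R]_(c k, p) :=
  \matrix_(t, f) (sample_scale (w k t) * Nblock k (w k t) f).

Definition Cmx (w : draws) : 'M[R]_(m, \sum_k c k) :=
  \mxrow_(k < K) Cblock w k.

Definition Dmx (w : draws) : 'M[R]_(\sum_k c k, p) :=
  \mxcol_(k < K) Dblock w k.

(* Division by zero gives [0], which includes the convention [0 / 0 = 0].  A
   lower bound on [pr] proportional to the norm products forces the numerator
   to vanish when [pr i = 0] and so excludes any other division by zero. *)
Definition sigma2 (h : 'I_m) (f : 'I_p) : R :=
  \sum_(k < K) \sum_(i < n k)
    (Mblock k h i ^+ 2 * Nblock k i f ^+ 2) / ((c k)%:R * pr i)
  - \sum_(k < K) ((Mblock k *m Nblock k) h f) ^+ 2 / (c k)%:R.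

End BlockSampling.

(* Main.v *)
Require Import Defs.
From mathcomp Require Import all_boot all_order all_algebra.
From mathcomp Require Import all_classical all_reals all_analysis.
From mathcomp Require Import ring lra zify.

Set Implicit Arguments.
Unset Strict Implicit.
Unset Printing Implicit Defensive.

Import Order.TTheory GRing.Theory Num.Theory.

Local Open Scope ring_scope.

(* Put W := sum_k block_weight k.  The prescribed block sizes make
   block_weight k / c_k = W / c independent of k, so every term
   M^k(i) N_k(i) / (c_k p_ki) of the sum CD has Frobenius norm at most
   W / (beta c), and the summed variance is at most
   phi^2 W^2 / (beta c), while W <= |M|_F |N|_F by Cauchy-Schwarz.
   The error |MN - CD|_F is a function of c independent draws.  Its mean is at
   most the square root of the summed variance, and changing one draw moves it
   by at most 2 W / (beta c), so a bounded-difference inequality of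
   Azuma-McDiarmid type bounds its deviation above the mean. *)

(** * Exponential inequalities *)

Lemma leq_expn_fact n : (2 ^ n * n`! <= n.*2`!)%N.
Proof.
elim: n => [|n IHn] //.
rewrite doubleS !factS expnS.
have -> : (2 * 2 ^ n * (n.+1 * n`!) = n.*2.+2 * (2 ^ n * n`!))%N.
  by rewrite -doubleS -mul2n; lia.
by rewrite leq_mul2l /= (leq_trans IHn)// leq_pmull.
Qed.

Section CoshBound.
Import numFieldNormedType.Exports.
Local Open Scope classical_set_scope.

(* Termwise comparison of the exponential series, as [2 ^ n * n! <= (2 n)!]. *)
Lemma cosh_le_expR (R : realType) (y : R) :
  (expR y + expR (- y)) / 2 <= expR (y ^+ 2 / 2).
Proof.
have cv (x : R) : series (exp_coeff x) @ \oo --> expR x.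
  exact: is_cvg_series_exp_coeff.
(* Summing the first [2n] terms on this side against [n] terms on the other pairs degrees [2k] and
   [2k + 1] with degree [k]; the odd degrees cancel between [y] and [- y]. *)
have cv2 : (series (exp_coeff y) \o double) n
    + (series (exp_coeff (- y)) \o double) n @[n --> \oo] --> expR y + expR (- y).
  have dbl : double @ \oo --> \oo.
    apply/cvgnyPge => A; near=> n.
    rewrite (@leq_trans n)//; last by rewrite -addnn leq_addr.
    by near: n; exact: nbhs_infty_ge.
  by apply: cvgD; apply: cvg_comp dbl (cv _).
rewrite ler_pdivrMr// mulrC.
have cv3 : 2 * series (exp_coeff (y ^+ 2 / 2)) n @[n --> \oo] --> 2 * expR (y ^+ 2 / 2).
  by apply: cvgM; [exact: cvg_cst|exact: cv].
apply: (ler_cvg_to cv2 cv3).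
near=> n => /=.
rewrite /series /= !big_mkord.
elim: (n) => [|k IHk]; first by rewrite !big_ord0 addr0 mulr0.
rewrite doubleS !big_ord_recr/= mulrDr.
suff : exp_coeff y k.*2 + exp_coeff y k.*2.+1
   + (exp_coeff (- y) k.*2 + exp_coeff (- y) k.*2.+1) <= 2 * exp_coeff (y ^+ 2 / 2) k.
  by move: IHk; lra.
rewrite /exp_coeff /= (exprS y k.*2) (exprS (- y) k.*2) mulNr -mul2n !exprM sqrrN.
rewrite [leLHS](_ : _ = 2 * ((y ^+ 2) ^+ k / (2 * k)`!%:R)); last by ring.
rewrite ler_pM2l// expr_div_n -mulrA.
rewrite ler_wpM2l ?(sqr_ge0, exprn_ge0)//.
rewrite -invfM lef_pV2 ?posrE ?mulr_gt0 ?exprn_gt0 ?ltr0n ?fact_gt0//.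
by rewrite -natrX -natrM ler_nat mul2n leq_expn_fact.
Unshelve. all: by end_near. Qed.

End CoshBound.

(* Both end points of the chord lie above the tangent at [u]. *)
Lemma expR_le_chord (R : realType) (d u : R) : `|u| <= d ->
  2 * d * expR u <= (d - u) * expR (- d) + (d + u) * expR d.
Proof.
rewrite ler_norml => /andP[ud du].
have tangent a : (1 + (a - u)) * expR u <= expR a.
  rewrite -[in leRHS](subrK u a) expRD ler_wpM2r ?expR_ge0//.
  exact: expR_ge1Dx.
have := ler_wpM2l (_ : 0 <= d + u) (tangent d).
have := ler_wpM2l (_ : 0 <= d - u) (tangent (- d)).
move=> /(_ ltac:(lra)) ? /(_ ltac:(lra)) ?; nra.
Qed.

(** * Moments on a finite probability space *)

Section FiniteMean.
Variables (R : realType) (T : finType) (q : T -> R).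
Hypotheses (q_ge0 : forall x, 0 <= q x) (q_sum1 : \sum_x q x = 1).

Lemma mean_le (f g : T -> R) : (forall x, f x <= g x) ->
  \sum_x q x * f x <= \sum_x q x * g x.
Proof. by move=> fg; apply: ler_sum => x _; rewrite ler_wpM2l. Qed.

Lemma mean_cst a : \sum_x q x * a = a.
Proof. by rewrite -mulr_suml q_sum1 mul1r. Qed.

(** A weak Hoeffding lemma: below its chord on [[-d, d]] the exponential is bounded by an affine
    function, whose linear part has mean zero, and what remains is cosh [d]. *)
Lemma mean_expR_centered (d : R) (u : T -> R) : (forall x, `|u x| <= d) ->
  \sum_x q x * u x = 0 -> \sum_x q x * expR (u x) <= expR (d ^+ 2 / 2).
Proof.
move=> ud u0; have [d0|d_le0] := ltP 0 d; last first.
  have u_eq0 x : u x = 0.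
    by apply/eqP; rewrite -normr_le0 (le_trans (ud x)).
  under eq_bigr do rewrite u_eq0 expR0.
  by rewrite mean_cst -expR0 ler_expR divr_ge0 ?sqr_ge0.
apply: le_trans (cosh_le_expR d).
rewrite -(ler_pM2l (_ : 0 < 2 * d)) ?mulr_gt0// big_distrr/=.
under eq_bigr do rewrite mulrCA.
apply: (@le_trans _ _ (\sum_x q x * ((d - u x) * expR (- d) + (d + u x) * expR d))).
  by apply: mean_le => x; exact: expR_le_chord.
rewrite le_eqVlt; apply/orP; left; apply/eqP.
rewrite (eq_bigr (fun x => q x * (d * (expR d + expR (- d)))
    + (q x * u x) * (expR d - expR (- d)))); last by move=> x _; ring.
by rewrite big_split/= -!mulr_suml q_sum1 u0; field.
Qed.

(** The deviation of [g x] from the mean is the average of the differences [g x - g y], so it is at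
    most [d] and the centred bound applies. *)
Lemma mean_expR_osc (d s : R) (g : T -> R) : 0 <= s ->
  (forall x y, `|g x - g y| <= d) ->
  \sum_x q x * expR (s * g x)
    <= expR (s * \sum_x q x * g x + s ^+ 2 * d ^+ 2 / 2).
Proof.
move=> s0 gd; set a := \sum_x _ * g x.
have ga x : `|g x - a| <= d.
  have -> : g x - a = \sum_y q y * (g x - g y).
    by under [RHS]eq_bigr do rewrite mulrBr; rewrite sumrB mean_cst.
  apply: le_trans (ler_norm_sum _ _ _) _; rewrite -[leRHS]mean_cst.
  by apply: ler_sum => y _; rewrite normrM ger0_norm// ler_wpM2l.
rewrite expRD mulrC -ler_pdivrMr ?expR_gt0// -expRN big_distrl/=.
rewrite -exprMn.
apply: (le_trans _ (@mean_expR_centered (s * d) (fun x => s * (g x - a)) _ _)).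
- by apply: ler_sum => x _; rewrite -mulrA -expRD mulrBr.
- by move=> x; rewrite normrM ger0_norm// ler_wpM2l.
- under eq_bigr do rewrite mulrCA.
  rewrite -big_distrr/=.
  under eq_bigr do rewrite mulrBr.
  by rewrite sumrB mean_cst subrr mulr0.
Qed.

(** The difference of the two sides is the variance of [f]. *)
Lemma sqr_mean_le (f : T -> R) :
  (\sum_x q x * f x) ^+ 2 <= \sum_x q x * f x ^+ 2.
Proof.
set a := \sum_x q x * f x; rewrite -subr_ge0.
have -> : \sum_x q x * f x ^+ 2 - a ^+ 2 = \sum_x q x * (f x - a) ^+ 2.
  transitivity (\sum_x (q x * f x ^+ 2 + q x * f x * (- (2 * a)) + q x * a ^+ 2)).
    by rewrite !big_split/= -!mulr_suml q_sum1 -/a; ring.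
  by apply: eq_bigr => x _; ring.
by apply: sumr_ge0 => x _; rewrite mulr_ge0 ?sqr_ge0.
Qed.

End FiniteMean.

(** * Product measures and bounded differences *)

(** Dependent functions are recoded as functions into the tagged union of the [T i], where the usual
    distributivity of products over sums applies. *)
Lemma prod_sum_dffun (R : comPzRingType) (I : finType) (T : I -> finType)
    (F : forall i, T i -> R) :
  \sum_(w : {dffun forall i, T i}) \prod_i F i (w i) = \prod_i \sum_x F i x.
Proof.
rewrite (reindex (@dffun_of_fprod I T)); last exact/onW_bij/dffun_of_fprod_bij.
under eq_bigr => t _ do under eq_bigr => i _ do rewrite ffunE.
have /= := @big_fprod R 0 1 *%R +%R I T (fun i => [ffun x => F i x]).
under eq_bigr => t _ do under eq_bigr => i _ do rewrite ffunE.
move=> ->; rewrite -(bigA_distr_big_dep _ (fun i u => untag 0 [ffun x => F i x] u)).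
apply: eq_bigr => i _; under [RHS]eq_bigr do rewrite -(ffunE (F i)).
exact/esym/(@big_tag R 0 +%R I T (fun i => finfun (F i))).
Qed.

Section ProductSpace.
Variables (R : realType) (I : finType) (T : I -> finType).
Variable q : forall i, T i -> R.
Hypotheses (q_ge0 : forall i (x : T i), 0 <= q x).
Hypotheses (q_sum1 : forall i, \sum_(x : T i) q x = 1).

Local Notation Om := {dffun forall i, T i}.

Definition prod_mass (w : Om) : R := \prod_i q (w i).

Definition prod_mean (f : Om -> R) : R := \sum_w prod_mass w * f w.

Definition resample (w : Om) i (x : T i) : Om := finfun (eqtype.dfwith w x).

Lemma prod_mass_ge0 w : 0 <= prod_mass w.
Proof. exact: prodr_ge0. Qed.

Lemma prod_mass_sum1 : \sum_w prod_mass w = 1.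
Proof. by rewrite prod_sum_dffun big1. Qed.

Lemma resample_in w i (x : T i) : resample w x i = x.
Proof. by rewrite ffunE dfwith_in. Qed.

Lemma resample_out w i (x : T i) j : i != j -> resample w x j = w j.
Proof. by move=> ij; rewrite ffunE dfwith_out. Qed.

Lemma resampleK w i (x : T i) : resample (resample w x) (w i) = w.
Proof.
apply/ffunP => j; have [<-|ij] := eqVneq i j; first by rewrite resample_in.
by rewrite !resample_out.
Qed.

Lemma prod_mass_resample w i (x : T i) :
  prod_mass (resample w x) * q (w i) = prod_mass w * q x.
Proof.
rewrite /prod_mass (bigD1 i)//= [in RHS](bigD1 i)//= resample_in [RHS]mulrC -!mulrA.
congr (_ * _).
rewrite [RHS]mulrC; congr (_ * _).
by apply: eq_bigr => j ji; rewrite resample_out// eq_sym.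
Qed.

(* Redrawing coordinate [i] and keeping the old value aside is a
   measure-preserving involution of [Om * T i]. *)
Lemma prod_mean_resample i (f : Om -> R) :
  prod_mean f = prod_mean (fun w => \sum_x q x * f (resample w (x : T i))).
Proof.
rewrite /prod_mean.
transitivity (\sum_w \sum_(x : T i) prod_mass w * q x * f w).
  by apply: eq_bigr => w _; rewrite -mulr_suml -mulr_sumr q_sum1 mulr1.
transitivity (\sum_w \sum_(x : T i) prod_mass w * q x * f (resample w x)); last first.
  by apply: eq_bigr => w _; rewrite mulr_sumr; apply: eq_bigr => x _; rewrite mulrA.
pose swap (u : Om * T i) := (resample u.1 u.2, u.1 i).
have swapK : involutive swap.
  by case=> w x; rewrite /swap/= resampleK resample_in.
rewrite !pair_big/= (reindex_inj (inv_inj swapK))/=.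
by apply: eq_bigr => -[w x] _ /=; rewrite prod_mass_resample.
Qed.

(** The conditional expectation of [f] given the coordinates outside [l]. Along the suffixes of
    [enum I] it runs through the Doob martingale of [f], from the mean to [f] itself. *)
Fixpoint iterated_mean (l : seq I) (f : Om -> R) (w : Om) : R :=
  if l is i :: l' then \sum_(x : T i) q x * iterated_mean l' f (resample w x) else f w.

Lemma prod_mean_iterated_mean l f : prod_mean (iterated_mean l f) = prod_mean f.
Proof. by elim: l => //= i l <-; rewrite -prod_mean_resample. Qed.

(** The coordinates in [l] are all overwritten before [f] is evaluated. *)
Lemma eq_iterated_mean l f (w w' : Om) : (forall i, i \notin l -> w i = w' i) ->
  iterated_mean l f w = iterated_mean l f w'.
Proof.
elim: l w w' => [|i l IHl] w w' eq_ww' /=.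
  by congr f; apply/ffunP => i; exact: eq_ww'.
apply: eq_bigr => x _; congr (_ * _); apply: IHl => j jl.
have [<-|ij] := eqVneq i j; first by rewrite !resample_in.
by rewrite !resample_out// eq_ww'// inE negb_or jl eq_sym ij.
Qed.

(** Once every coordinate is averaged out the function is constant, hence equal to its own mean,
    which averaging has preserved. *)
Lemma iterated_mean_enum f w : iterated_mean (enum I) f w = prod_mean f.
Proof.
rewrite -(prod_mean_iterated_mean (enum I)) /prod_mean.
rewrite -[LHS]mul1r -prod_mass_sum1 mulr_suml; apply: eq_bigr => w' _.
by congr (_ * _); apply: eq_iterated_mean => i; rewrite mem_enum.
Qed.

Section BoundedDifferences.
Variables (d : R) (f : Om -> R).
Hypothesis f_diff : forall (w w' : Om) i,
  (forall j, j != i -> w j = w' j) -> `|f w - f w'| <= d.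

(** Averaging keeps bounded differences because both points are resampled with the same value
    [x]. *)
Lemma iterated_mean_diff l (w w' : Om) i :
  (forall j, j != i -> w j = w' j) -> `|iterated_mean l f w - iterated_mean l f w'| <= d.
Proof.
elim: l w w' => [|j l IHl] w w' eq_ww' /=; first exact: f_diff eq_ww'.
rewrite -sumrB; apply: le_trans (ler_norm_sum _ _ _) _.
rewrite -[leRHS](mean_cst (@q_sum1 j)); apply: ler_sum => x _.
rewrite -mulrBr normrM ger0_norm// ler_wpM2l// IHl// => k ki.
have [<-|jk] := eqVneq j k; first by rewrite !resample_in.
by rewrite !resample_out// eq_ww'.
Qed.

(** Each averaged coordinate costs one factor [expR (s ^+ 2 * d ^+ 2 / 2)], since the conditional
    expectation oscillates by at most [d] in that coordinate. *)
Lemma iterated_mean_expR_le l s w : 0 <= s ->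
  iterated_mean l (fun w' => expR (s * f w')) w
    <= expR (s * iterated_mean l f w + (size l)%:R * (s ^+ 2 * d ^+ 2 / 2)).
Proof.
move=> s0; elim: l w => [|i l IHl] w /=; first by rewrite mul0r addr0.
apply: (@le_trans _ _ (\sum_(x : T i) q x *
    (expR (s * iterated_mean l f (resample w x)) * expR ((size l)%:R * (s ^+ 2 * d ^+ 2 / 2))))).
  by apply: mean_le => // x; rewrite -expRD; exact: IHl.
under [leLHS]eq_bigr do rewrite mulrA.
rewrite -mulr_suml -[(size l).+1%:R]natr1 mulrDl mul1r addrCA addrC expRD.
rewrite ler_wpM2r ?expR_ge0//.
apply: (@mean_expR_osc _ _ _ (@q_ge0 i) (@q_sum1 i) d s) => // x y.
apply: (@iterated_mean_diff _ _ _ i) => j ji.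
by rewrite !resample_out// eq_sym.
Qed.

(* The exponent is a quarter of the optimal one, because the one-step bound only
   uses that the centred increments are at most [d] in absolute value. *)
Lemma mcdiarmid t : 0 < d -> (0 < #|I|)%N -> 0 <= t ->
  \sum_(w | prod_mean f + t <= f w) prod_mass w
    <= expR (- (t ^+ 2 / (2 * #|I|%:R * d ^+ 2))).
Proof.
move=> d0 I0 t0; have c0 : 0 < #|I|%:R :> R by rewrite ltr0n.
(* This [s] minimizes the exponent [- s * t + c * s ^+ 2 * d ^+ 2 / 2]. *)
set c : R := #|I|%:R in c0 *; pose s := t / (c * d ^+ 2).
have cd0 : 0 < c * d ^+ 2 by rewrite mulr_gt0// exprn_gt0.
have s0 : 0 <= s by rewrite divr_ge0// ltW.
pose a := s * (prod_mean f + t).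
(* Exponential Markov inequality: on the event, [expR (s * f w - a)] is at least [1]. *)
apply: (@le_trans _ _ (expR (- a) * prod_mean (fun w => expR (s * f w)))).
  rewrite mulrC -ler_pdivrMr ?expR_gt0// -expRN opprK mulr_suml.
  rewrite [leLHS]big_mkcond; apply: ler_sum => w _; case: ifPn => [fw|_].
    by rewrite ler_wpM2l ?prod_mass_ge0// ler_expR ler_wpM2l.
  by rewrite mulr_ge0 ?prod_mass_ge0 ?expR_ge0.
(* [iterated_mean] needs a base point; on an empty space the mean is an empty sum and the bound is
   trivial. *)
have [w _|Om0] := pickP {: Om}; last first.
  by rewrite /prod_mean big_pred0// mulr0 expR_ge0.
have := iterated_mean_expR_le (enum I) w s0; rewrite !iterated_mean_enum -cardE -/c => le_mgf.
apply: le_trans (ler_wpM2l (expR_ge0 _) le_mgf) _.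
rewrite -expRD ler_expR le_eqVlt; apply/orP; left; apply/eqP.
by rewrite /a /s; field; rewrite !gt_eqF.
Qed.

End BoundedDifferences.

Lemma prod_mean1 (i : I) (g : T i -> R) :
  prod_mean (fun w => g (w i)) = \sum_x q x * g x.
Proof.
rewrite (prod_mean_resample i) /prod_mean.
under eq_bigr do under eq_bigr do rewrite resample_in.
by rewrite -mulr_suml prod_mass_sum1 mul1r.
Qed.

(** Variances of independent centred terms add up: resampling coordinate [i] alone kills each cross
    term. *)
Lemma prod_mean_sqr_sum (g : forall i, T i -> R) :
  (forall i, \sum_x q x * g i x = 0) ->
  prod_mean (fun w => (\sum_i g i (w i)) ^+ 2) = \sum_i \sum_x q x * g i x ^+ 2.
Proof.
move=> g0.
have cross i j : i != j -> prod_mean (fun w => g i (w i) * g j (w j)) = 0.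
  move=> ij; rewrite (prod_mean_resample i) /prod_mean big1// => w _.
  under eq_bigr do rewrite resample_in resample_out// mulrA.
  by rewrite -mulr_suml g0 mul0r mulr0.
transitivity (\sum_i \sum_j prod_mean (fun w => g i (w i) * g j (w j))).
  rewrite /prod_mean; under [RHS]eq_bigr do rewrite exchange_big/=.
  rewrite exchange_big/=; apply: eq_bigr => w _.
  rewrite expr2 mulr_suml mulr_sumr; apply: eq_bigr => i _.
  by rewrite !mulr_sumr.
apply: eq_bigr => i _; rewrite (bigD1 i)//= big1 ?addr0; last first.
  by move=> j ji; rewrite cross// eq_sym.
by rewrite -(@prod_mean1 i (fun x => g i x ^+ 2)); apply: eq_bigr => w _; rewrite expr2.
Qed.

End ProductSpace.

(** * Cauchy-Schwarz and the Frobenius norm *)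

(** With [A], [B], [C] as in the proof, [A * (A * B - C ^+ 2)] is the sum of the squares of
    [A * b i - C * a i]; the case [A = 0] forces [a] to vanish. *)
Lemma sum_mul_sqr_le (R : realType) (I : finType) (a b : I -> R) :
  (\sum_i a i * b i) ^+ 2 <= (\sum_i a i ^+ 2) * (\sum_i b i ^+ 2).
Proof.
set A := \sum_i a i ^+ 2; set B := \sum_i b i ^+ 2; set C := \sum_i _.
have [A0|A_neq0] := eqVneq A 0.
  have a0 i : a i = 0.
    apply/eqP; rewrite -sqrf_eq0; apply/eqP.
    by apply: (psumr_eq0P _ A0) => // j _; exact: sqr_ge0.
  by rewrite /C big1 => [|i _]; rewrite ?a0 ?mul0r// A0 mul0r expr0n.
have A_gt0 : 0 < A by rewrite lt_def A_neq0 sumr_ge0// => i _; exact: sqr_ge0.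
rewrite -subr_ge0 -(pmulr_rge0 _ A_gt0).
have -> : A * (A * B - C ^+ 2) = \sum_i (A * b i - C * a i) ^+ 2.
  transitivity (\sum_i (A ^+ 2 * b i ^+ 2 + (- (2 * A * C)) * (a i * b i)
      + C ^+ 2 * a i ^+ 2)).
    by rewrite !big_split/= -!mulr_sumr -/A -/B -/C; ring.
  by apply: eq_bigr => i _; ring.
by apply: sumr_ge0 => i _; exact: sqr_ge0.
Qed.

Section Frobenius.
Variable R : realType.

Lemma normF_ge0 m n (A : 'M[R]_(m, n)) : 0 <= normF A.
Proof. exact: sqrtr_ge0. Qed.

Lemma normF_sqr m n (A : 'M[R]_(m, n)) :
  normF A ^+ 2 = \sum_i \sum_j A i j ^+ 2.
Proof.
by rewrite sqr_sqrtr// sumr_ge0// => i _; rewrite sumr_ge0// => j _; exact: sqr_ge0.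
Qed.

Lemma normF_eq0 m n (A : 'M[R]_(m, n)) : normF A = 0 -> A = 0.
Proof.
move=> A0; apply/matrixP => i j; rewrite mxE.
have : \sum_i \sum_j A i j ^+ 2 = 0 by rewrite -normF_sqr A0 expr0n.
rewrite pair_big/= => /psumr_eq0P/= sqr0; apply/eqP; rewrite -sqrf_eq0.
by apply/eqP/(sqr0 _ (i, j)) => // u _; exact: sqr_ge0.
Qed.

Lemma normFZ m n a (A : 'M[R]_(m, n)) : normF (a *: A) = `|a| * normF A.
Proof.
apply/eqP; rewrite -(@eqrXn2 _ 2)// ?mulr_ge0 ?normF_ge0// exprMn real_normK ?num_real//.
rewrite !normF_sqr mulr_sumr; apply/eqP/eq_bigr => i _.
by rewrite mulr_sumr; apply: eq_bigr => j _; rewrite mxE exprMn.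
Qed.

Lemma normFN m n (A : 'M[R]_(m, n)) : normF (- A) = normF A.
Proof. by rewrite -scaleN1r normFZ normrN1 mul1r. Qed.

Lemma ler_normFD m n (A B : 'M[R]_(m, n)) : normF (A + B) <= normF A + normF B.
Proof.
rewrite -ler_sqr ?nnegrE ?addr_ge0 ?normF_ge0// sqrrD !normF_sqr !pair_big/=.
set a := \sum_p A p.1 p.2 ^+ 2; set b := \sum_p B p.1 p.2 ^+ 2.
have AB : \sum_p A p.1 p.2 * B p.1 p.2 <= normF A * normF B.
  apply: le_trans (ler_norm _) _.
  rewrite -ler_sqr ?nnegrE ?mulr_ge0 ?normF_ge0// real_normK ?num_real//.
  by rewrite exprMn !normF_sqr !pair_big; exact: sum_mul_sqr_le.
have -> : \sum_p (A + B) p.1 p.2 ^+ 2 = a + 2 * (\sum_p A p.1 p.2 * B p.1 p.2) + b.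
  rewrite mulr_sumr -!big_split/=; apply: eq_bigr => p _; rewrite mxE; ring.
by rewrite -mulr_natl; lra.
Qed.

Lemma ler_normF_dist m n (A B : 'M[R]_(m, n)) :
  `|normF A - normF B| <= normF (A - B).
Proof.
rewrite ler_norml; apply/andP; split.
  by have := ler_normFD (B - A) A; rewrite subrK -[normF (B - A)]normFN opprB; lra.
by have := ler_normFD (A - B) B; rewrite subrK; lra.
Qed.

Lemma normF_outer m n (A : 'cV[R]_m) (B : 'rV[R]_n) :
  normF (A *m B) = normF A * normF B.
Proof.
apply/eqP; rewrite -(@eqrXn2 _ 2)// ?mulr_ge0 ?normF_ge0// exprMn !normF_sqr.
rewrite big_ord1 mulr_suml; apply/eqP/eq_bigr => i _.
rewrite big_ord1 mulr_sumr; apply: eq_bigr => j _.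
by rewrite mxE big_ord1 exprMn.
Qed.

Lemma normF_sqr_tr m n (A : 'M[R]_(m, n)) : normF A ^+ 2 = \tr (A *m A^T).
Proof.
rewrite normF_sqr; apply: eq_bigr => i _; rewrite mxE.
by apply: eq_bigr => j _; rewrite mxE expr2.
Qed.

Lemma normF_sqr_col m n (A : 'M[R]_(m, n)) :
  normF A ^+ 2 = \sum_j normF (col j A) ^+ 2.
Proof.
rewrite normF_sqr exchange_big; apply: eq_bigr => j _.
by rewrite normF_sqr; apply: eq_bigr => i _; rewrite big_ord1 mxE.
Qed.

Lemma normF_sqr_row m n (A : 'M[R]_(m, n)) :
  normF A ^+ 2 = \sum_i normF (row i A) ^+ 2.
Proof.
rewrite normF_sqr; apply: eq_bigr => i _.
by rewrite normF_sqr big_ord1; apply: eq_bigr => j _; rewrite mxE.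
Qed.

End Frobenius.

(** * Variance and sensitivity of the sampled product *)

Section Sampling.
Variables (R : realType) (m p K : nat) (n : 'I_K -> nat).
Variables (M : 'M[R]_(m, \sum_k n k)) (N : 'M[R]_(\sum_k n k, p)).
Variables (c : 'I_K -> nat) (pr : forall k, 'I_(n k) -> R).

Lemma block_weight_ge0 k : 0 <= block_weight M N k.
Proof. by apply: sumr_ge0 => i _; rewrite mulr_ge0 ?normF_ge0. Qed.

Lemma normF_sqr_Mblock : \sum_k normF (Mblock M k) ^+ 2 = normF M ^+ 2.
Proof.
rewrite normF_sqr_tr -[in RHS](submxrowK M) tr_mxrow mul_mxrow_mxcol.
by rewrite raddf_sum; apply: eq_bigr => k _; rewrite normF_sqr_tr.
Qed.

Lemma normF_sqr_Nblock : \sum_k normF (Nblock N k) ^+ 2 = normF N ^+ 2.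
Proof.
rewrite normF_sqr_tr mxtrace_mulC -[in RHS](submxcolK N) tr_mxcol mul_mxrow_mxcol.
by rewrite raddf_sum; apply: eq_bigr => k _; rewrite normF_sqr_tr mxtrace_mulC.
Qed.

(** One Cauchy-Schwarz over all pairs (block, index), as the squared column norms of the blocks sum
    to [normF M ^+ 2] and the row norms to [normF N ^+ 2]. *)
Lemma sum_block_weight_le : \sum_k block_weight M N k <= normF M * normF N.
Proof.
rewrite -ler_sqr ?nnegrE ?mulr_ge0 ?normF_ge0//; last first.
  by apply: sumr_ge0 => k _; exact: block_weight_ge0.
rewrite exprMn -normF_sqr_Mblock -normF_sqr_Nblock.
under [X in _ <= X * _]eq_bigr do rewrite normF_sqr_col.
under [X in _ <= _ * X]eq_bigr do rewrite normF_sqr_row.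
by rewrite /block_weight !sig_big_dep; exact: sum_mul_sqr_le.
Qed.

(** The rank-one contribution of a single draw to CD: the two square-root scalings multiply to the
    inverse of [c k * pr i]. *)
Definition sample_term k (i : 'I_(n k)) : 'M[R]_(m, p) :=
  ((c k)%:R * pr i)^-1 *: (col i (Mblock M k) *m row i (Nblock N k)).

Hypotheses (pr_ge0 : forall k (i : 'I_(n k)), 0 <= pr i).

Lemma sample_termE k (i : 'I_(n k)) h f :
  sample_term i h f = ((c k)%:R * pr i)^-1 * (Mblock M k h i * Nblock N k i f).
Proof. by rewrite mxE mxE big_ord1 [col _ _ _ _]mxE [row _ _ _ _]mxE. Qed.

Lemma mulmx_CD w :
  Cmx M pr w *m Dmx N pr w = \sum_k \sum_(t < c k) sample_term (w k t).
Proof.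
rewrite mul_mxrow_mxcol; apply: eq_bigr => k _.
apply/matrixP => h f; rewrite mxE summxE; apply: eq_bigr => t _.
rewrite sample_termE [Cblock _ _ _ _ _ _]mxE [Dblock _ _ _ _ _ _]mxE.
rewrite mulrACA -expr2 exprVn sqr_sqrtr//.
by rewrite mulr_ge0.
Qed.

Lemma mulmx_blocks : M *m N = \sum_k Mblock M k *m Nblock N k.
Proof. by rewrite -mul_mxrow_mxcol submxrowK submxcolK. Qed.

Hypotheses (c_gt0 : forall k, (0 < c k)%N).
Hypotheses (pr_sum1 : forall k, \sum_(i < n k) pr i = 1).
Hypotheses (pr_supp : forall k (i : 'I_(n k)), pr i = 0 ->
  col i (Mblock M k) *m row i (Nblock N k) = 0).

Lemma pr_supp_entry k (i : 'I_(n k)) h f : pr i = 0 ->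
  Mblock M k h i * Nblock N k i f = 0.
Proof.
move=> /pr_supp/matrixP/(_ h f).
by rewrite mxE big_ord1 [col _ _ _ _]mxE [row _ _ _ _]mxE [RHS]mxE.
Qed.

Lemma sample_term_mean k h f :
  \sum_(i < n k) pr i * sample_term i h f = (Mblock M k *m Nblock N k) h f / (c k)%:R.
Proof.
rewrite [X in _ = X / _]mxE mulr_suml; apply: eq_bigr => i _; rewrite sample_termE.
(* An index of probability zero is never drawn, and unbiasedness survives because its share of the
   exact product is zero. *)
have [pr0|pr_neq0] := eqVneq (pr i) 0; first by rewrite pr0 mul0r pr_supp_entry// mul0r.
by field; rewrite pr_neq0 pnatr_eq0 -lt0n c_gt0.
Qed.

(** The variance of one draw; the outer division by [c k] disappears when the [c k] draws of the
    block are added, which leaves the block's share of [sigma2]. *)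
Lemma sample_term_var k h f :
  \sum_(i < n k)
     pr i * ((Mblock M k *m Nblock N k) h f / (c k)%:R - sample_term i h f) ^+ 2
  = (\sum_(i < n k) (Mblock M k h i ^+ 2 * Nblock N k i f ^+ 2) / ((c k)%:R * pr i)
     - ((Mblock M k *m Nblock N k) h f) ^+ 2 / (c k)%:R) / (c k)%:R.
Proof.
set a := (_ *m _) h f; have c_neq0 : (c k)%:R != 0 :> R by rewrite pnatr_eq0 -lt0n.
transitivity (\sum_(i < n k) (pr i * (a / (c k)%:R) ^+ 2
    + (pr i * sample_term i h f) * (- 2 * (a / (c k)%:R))
    + ((Mblock M k h i ^+ 2 * Nblock N k i f ^+ 2) / ((c k)%:R * pr i)) / (c k)%:R)).
  apply: eq_bigr => i _; rewrite sample_termE.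
  have [pr0|pr_neq0] := eqVneq (pr i) 0.
    by rewrite pr0 !(mulr0, mul0r, invr0) !addr0.
  by field; rewrite pr_neq0 c_neq0.
rewrite !big_split/= -!mulr_suml pr_sum1 sample_term_mean -/a.
by field.
Qed.

Lemma sum_sigma2 : \sum_h \sum_f sigma2 M N c pr h f =
  \sum_k (\sum_(i < n k) (normF (col i (Mblock M k)) * normF (row i (Nblock N k))) ^+ 2
                          / ((c k)%:R * pr i)
           - normF (Mblock M k *m Nblock N k) ^+ 2 / (c k)%:R).
Proof.
rewrite /sigma2; under eq_bigr do under eq_bigr do rewrite -sumrB.
under eq_bigr do rewrite exchange_big/=.
rewrite exchange_big; apply: eq_bigr => k _ /=.
under eq_bigr do rewrite sumrB exchange_big/=.
rewrite sumrB exchange_big/=; congr (_ - _).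
  apply: eq_bigr => i _; rewrite -normF_outer normF_sqr mulr_suml.
  apply: eq_bigr => h _; rewrite mulr_suml; apply: eq_bigr => f _.
  by rewrite [(_ *m _) h f]mxE big_ord1 [col _ _ _ _]mxE [row _ _ _ _]mxE exprMn.
rewrite normF_sqr mulr_suml; apply: eq_bigr => h _.
by rewrite mulr_suml.
Qed.

(** One coordinate per draw: [draws] has one factor per block, whereas the bounded-difference
    inequality must change one draw at a time. *)
Let J : finType := {k : 'I_K & 'I_(c k)}.
Let T (j : J) : finType := 'I_(n (tag j)).
Let Om : finType := {dffun forall j : J, T j}.
Let q (j : J) (x : T j) : R := pr x.

Definition flatten_draws (w : draws n c) : Om :=
  [ffun j : J => w (tag j) (tagged j)].

Definition unflatten_draws (u : Om) : draws n c :=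
  [ffun k => [ffun t => u (Tagged (fun k => 'I_(c k)) t)]].

Lemma flatten_drawsK : cancel flatten_draws unflatten_draws.
Proof. by move=> w; apply/ffunP => k; apply/ffunP => t; rewrite !ffunE. Qed.

Lemma unflatten_drawsK : cancel unflatten_draws flatten_draws.
Proof. by move=> u; apply/ffunP => -[k t]; rewrite !ffunE. Qed.

Lemma draws_mass_flatten w : draws_mass pr w = prod_mass q (flatten_draws w).
Proof.
rewrite /draws_mass (sig_big_dep xpredT (fun _ => xpredT)
  (fun k (t : 'I_(c k)) => pr (w k t)))/=.
by apply: eq_bigr => j _; rewrite ffunE.
Qed.

Lemma draws_prob_flatten (P : pred Om) :
  draws_prob pr [set w | P (flatten_draws w)]%SET = \sum_(u | P u) prod_mass q u.
Proof.
rewrite /draws_prob [RHS](reindex flatten_draws)/=.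
  by apply: eq_big => w; rewrite ?inE// => _; exact: draws_mass_flatten.
apply: onW_bij; exists unflatten_draws; first exact: flatten_drawsK.
exact: unflatten_drawsK.
Qed.

Definition sample_error (u : Om) : R :=
  normF (M *m N - \sum_(j : J) sample_term (u j)).

Lemma sample_error_flatten w :
  sample_error (flatten_draws w) = normF (M *m N - Cmx M pr w *m Dmx N pr w).
Proof.
rewrite mulmx_CD (sig_big_dep xpredT (fun _ => xpredT)
  (fun k (t : 'I_(c k)) => sample_term (w k t)))/=.
by congr (normF (_ - _)); apply: eq_bigr => j _; rewrite ffunE.
Qed.

(** The exact product is spread over the draws, each draw of block [k] receiving its mean, the block
    product over [c k]. Every entry of the error is then a sum of independent centred terms. *)
Lemma sample_error_mean_sqr :
  prod_mean q (fun u => sample_error u ^+ 2) = \sum_h \sum_f sigma2 M N c pr h f.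
Proof.
pose g h f (j : J) (x : T j) :=
  (Mblock M (tag j) *m Nblock N (tag j)) h f / (c (tag j))%:R - sample_term x h f.
transitivity (\sum_h \sum_f prod_mean q (fun u => (\sum_j g h f j (u j)) ^+ 2)).
  rewrite /prod_mean; under [RHS]eq_bigr do rewrite exchange_big/=.
  rewrite exchange_big/=; apply: eq_bigr => u _; rewrite normF_sqr mulr_sumr.
  apply: eq_bigr => h _; rewrite mulr_sumr; apply: eq_bigr => f _.
  congr (_ * _ ^+ 2); rewrite /g sumrB mulmx_blocks [LHS]mxE [X in _ + X = _]mxE.
  congr (_ - _); last by rewrite summxE.
  rewrite summxE -(sig_big_dep xpredT (fun _ => xpredT) (fun k (t : 'I_(c k)) =>
    (Mblock M k *m Nblock N k) h f / (c k)%:R))/=.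
  apply: eq_bigr => k _; rewrite sumr_const card_ord -[RHS]mulr_natr divfK//.
  by rewrite pnatr_eq0 -lt0n.
apply: eq_bigr => h _; apply: eq_bigr => f _.
rewrite prod_mean_sqr_sum; last 2 first.
- by move=> j; exact: pr_sum1.
- move=> j; rewrite /g; under eq_bigr do rewrite mulrBr.
  by rewrite sumrB sample_term_mean (mean_cst (@pr_sum1 (tag j))) subrr.
rewrite -(sig_big_dep xpredT (fun _ => xpredT) (fun k (t : 'I_(c k)) =>
  \sum_(x < n k)
    pr x * ((Mblock M k *m Nblock N k) h f / (c k)%:R - sample_term x h f) ^+ 2))/=.
rewrite /sigma2 -sumrB; apply: eq_bigr => k _.
rewrite sumr_const card_ord -[LHS]mulr_natr sample_term_var divfK//.
by rewrite pnatr_eq0 -lt0n.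
Qed.

Lemma sample_error_mean_le :
  prod_mean q sample_error ^+ 2 <= \sum_h \sum_f sigma2 M N c pr h f.
Proof.
rewrite -sample_error_mean_sqr; apply: sqr_mean_le.
- by move=> u; apply: prod_mass_ge0 => j x; exact: pr_ge0.
- by apply: prod_mass_sum1 => j; exact: pr_sum1.
Qed.

(** After the reverse triangle inequality only the two terms of the changed draw survive. *)
Lemma sample_error_diff b : (forall k (i : 'I_(n k)), normF (sample_term i) <= b) ->
  forall (u u' : Om) j, (forall j', j' != j -> u j' = u' j') ->
  `|sample_error u - sample_error u'| <= 2 * b.
Proof.
move=> term_le u u' j eq_uu'; apply: le_trans (ler_normF_dist _ _) _.
rewrite (bigD1 j)//= [in X in _ - X](bigD1 j)//=.
rewrite (eq_bigr (fun j' => sample_term (u' j'))); last by move=> j' /eq_uu' ->.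
set S : 'M[R]_(m, p) := \sum_(_ | _) _.
have -> : M *m N - (sample_term (u j) + S) - (M *m N - (sample_term (u' j) + S))
  = sample_term (u' j) + - sample_term (u j).
  by apply/matrixP => h f; rewrite !mxE; ring.
apply: le_trans (ler_normFD _ _) _; rewrite normFN mulr_natl mulr2n.
by apply: lerD; exact: term_le.
Qed.

Lemma card_draw_slots : #|J| = \sum_k c k.
Proof.
rewrite -sum1_card.
rewrite -(sig_big_dep xpredT (fun _ => xpredT) (fun k (t : 'I_(c k)) => 1%N))/=.
by apply: eq_bigr => k _; rewrite sum1_card card_ord.
Qed.

End Sampling.

(** * The variance bound and the tail bound *)

Theorem theorem6 (R : realType) (m p K : nat) (n : 'I_K -> nat)
    (M : 'M[R]_(m, \sum_k n k)) (N : 'M[R]_(\sum_k n k, p))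
    (c : 'I_K -> nat) (pr : forall k : 'I_K, 'I_(n k) -> R)
    (v : 'I_K -> R) (theta1 theta2 beta : R)
    (c_bounds : forall k, (1 <= c k <= n k)%N)
    (pr_ge0 : forall k i, 0 <= pr k i)
    (pr_sum1 : forall k, \sum_i pr k i = 1)
    (weight_neq0 : forall k, block_weight M N k != 0)
    (total_weight_neq0 : \sum_l block_weight M N l != 0)
    (v_bounds : forall k, 0 <= v k <= 1)
    (v_def : forall k,
       v k * block_weight M N k = normF (Mblock M k *m Nblock N k))
    (theta_bounds : 0 <= theta1 /\ theta1 <= theta2 /\ theta2 <= 1)
    (v_theta : forall k, theta1 <= 1 - v k ^+ 2 <= theta2)
    (beta_bounds : 0 < beta <= 1)
    (pr_lower : forall k i,
       beta * normF (col i (Mblock M k)) * normF (row i (Nblock N k))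
         / block_weight M N k <= pr k i)
    (c_def : forall k,
       (c k)%:R = (\sum_l c l)%:R * block_weight M N k
                    / \sum_l block_weight M N l) :
  let ctot : R := (\sum_k c k)%:R in
  let phi : R := Num.sqrt (1 - beta * (1 - theta2)) in
  \sum_h \sum_f sigma2 M N c pr h f
    <= phi ^+ 2 / (beta * ctot) * normF M ^+ 2 * normF N ^+ 2
  /\
  forall delta : R, 0 < delta < 1 ->
    let eta : R := phi + Num.sqrt (8 / beta * ln (1 / delta)) in
    1 - delta <=
      draws_prob pr
        [set w : draws n c |
          normF (M *m N - Cmx M pr w *m Dmx N pr w) ^+ 2
            <= eta ^+ 2 / (beta * ctot) * normF M ^+ 2 * normF N ^+ 2]%SET.
Proof.
move=> ctot phi.
have [beta0 beta1] := andP beta_bounds; have [_ [_ theta2_le1]] := theta_bounds.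
pose w k := block_weight M N k; pose W := \sum_k w k.
have w_gt0 k : 0 < w k by rewrite lt_def weight_neq0 block_weight_ge0.
have W_gt0 : 0 < W.
  by rewrite lt_def total_weight_neq0 sumr_ge0// => k _; exact: block_weight_ge0.
have c_gt0 k : (0 < c k)%N by case/andP: (c_bounds k).
have cR_gt0 k : 0 < (c k)%:R :> R by rewrite ltr0n.
have ctot_gt0 : 0 < ctot.
  have [k _|K0] := pickP {: 'I_K}; last first.
    by move: total_weight_neq0; rewrite big_pred0// eqxx.
  by rewrite ltr0n (bigD1 k)//= addn_gt0 c_gt0.
have w_div_c k : w k / (c k)%:R = W / ctot.
  by rewrite c_def -/ctot -/(w k) -/W; field; rewrite !gt_eqF.
pose a k (i : 'I_(n k)) := normF (col i (Mblock M k)) * normF (row i (Nblock N k)).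
have a_ge0 k i : 0 <= a k i by rewrite mulr_ge0 ?normF_ge0.
have a_le k i : a k i <= pr k i * w k / beta.
  have := pr_lower k i; rewrite ler_pdivrMr ?w_gt0// -mulrA => ?.
  by rewrite ler_pdivlMr// mulrC.
have a_div k i : a k i / ((c k)%:R * pr k i) <= W / (beta * ctot).
  (* At probability zero the quotient on the left is [0] by convention. *)
  have [pr0|pr_neq0] := eqVneq (pr k i) 0.
    by rewrite pr0 mulr0 invr0 mulr0 divr_ge0 ?mulr_ge0 ?ltW.
  have pr_gt0 : 0 < pr k i by rewrite lt_def pr_neq0 pr_ge0.
  rewrite ler_pdivrMr ?mulr_gt0//; apply: le_trans (a_le k i) _.
  rewrite le_eqVlt; apply/orP; left; apply/eqP.
  have -> : W / (beta * ctot) = (W / ctot) / beta by field; rewrite !gt_eqF.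
  by rewrite -(w_div_c k); field; rewrite !gt_eqF.
have pr_supp k i : pr k i = 0 -> col i (Mblock M k) *m row i (Nblock N k) = 0.
  move=> pr0; apply: normF_eq0; rewrite normF_outer; apply/eqP.
  by rewrite eq_le a_ge0 andbT; have := a_le k i; rewrite pr0 !mul0r.
have term_le k (i : 'I_(n k)) : normF (sample_term M N c pr i) <= W / (beta * ctot).
  rewrite normFZ normF_outer ger0_norm ?invr_ge0 ?mulr_ge0//.
  by rewrite mulrC; exact: a_div.
have phi_sqr : phi ^+ 2 = 1 - beta * (1 - theta2) by rewrite sqr_sqrtr//; nra.
have var_le : \sum_h \sum_f sigma2 M N c pr h f <= phi ^+ 2 / (beta * ctot) * W ^+ 2.
  rewrite sum_sigma2.
  have -> : phi ^+ 2 / (beta * ctot) * W ^+ 2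
      = \sum_k w k * (W / (beta * ctot) * phi ^+ 2).
    by rewrite -mulr_suml -/W; field; rewrite !gt_eqF.
  apply: ler_sum => k _; rewrite -v_def -/(w k).
  have sum_le : \sum_(i < n k) a k i ^+ 2 / ((c k)%:R * pr k i)
      <= w k * (W / (beta * ctot)).
    rewrite [leRHS]mulr_suml; apply: ler_sum => i _; rewrite expr2 -mulrA.
    by rewrite ler_wpM2l.
  apply: le_trans (lerB sum_le (lexx _)) _.
  (* The subtracted term is the fraction [beta * v k ^+ 2] of the bound on the first sum. The
     remaining fraction is at most [phi ^+ 2], because [1 - theta2 <= v k ^+ 2]. *)
  have -> : (v k * w k) ^+ 2 / (c k)%:R = w k * (W / ctot) * v k ^+ 2.
    by rewrite -(w_div_c k); field; rewrite gt_eqF.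
  have -> : w k * (W / ctot) * v k ^+ 2 = w k * (W / (beta * ctot)) * (beta * v k ^+ 2).
    by field; rewrite !gt_eqF.
  rewrite -[X in X - _]mulr1 -mulrBr [leRHS]mulrA ler_wpM2l//.
    by rewrite mulr_ge0 ?divr_ge0 ?mulr_ge0 ?ltW.
  by rewrite phi_sqr; case/andP: (v_theta k) => _; nra.
have W_le : W <= normF M * normF N := sum_block_weight_le M N.
have bc_gt0 : 0 < beta * ctot by rewrite mulr_gt0.
have scale_le x : 0 <= x ->
    x / (beta * ctot) * W ^+ 2 <= x / (beta * ctot) * normF M ^+ 2 * normF N ^+ 2.
  move=> x0; rewrite -[leRHS]mulrA -exprMn; apply: ler_wpM2l.
    by rewrite divr_ge0// ltW.
  by rewrite ler_sqr ?nnegrE ?mulr_ge0 ?normF_ge0// ltW.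
split; first by apply: le_trans var_le _; apply: scale_le; exact: sqr_ge0.
move=> delta /andP[delta0 delta1]; cbv zeta; set eta := phi + _.
(* The unit of length of the error: [phi * r] bounds its mean, and [eta * r] is the threshold before
   [W] is replaced by the product of the norms. *)
pose r := W / Num.sqrt (beta * ctot).
have r_gt0 : 0 < r by rewrite divr_gt0// sqrtr_gt0.
have r_sqr : r ^+ 2 = W ^+ 2 / (beta * ctot) by rewrite expr_div_n sqr_sqrtr// ltW.
pose L := ln (1 / delta).
have L_gt0 : 0 < L by rewrite ln_gt0// div1r invf_gt1.
(* Chosen so that [phi * r + t = eta * r] and the bounded-difference exponent with
   [d = 2 * (W / (beta * ctot))] is exactly [L]. *)
pose t := Num.sqrt (8 / beta * L) * r.
have t_sqr : t ^+ 2 = 8 / beta * L * (W ^+ 2 / (beta * ctot)).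
  by rewrite exprMn r_sqr sqr_sqrtr// mulr_ge0 ?divr_ge0 ?ltW.
have phi_ge0 : 0 <= phi by exact: sqrtr_ge0.
have eta_ge0 : 0 <= eta by rewrite addr_ge0 ?sqrtr_ge0.
pose T (j : {k : 'I_K & 'I_(c k)}) : finType := 'I_(n (tag j)).
pose q j (x : T j) : R := pr (tag j) x.
have q_ge0 j (x : T j) : 0 <= q j x by exact: pr_ge0.
have q_sum1 j : \sum_(x : T j) q j x = 1 by exact: pr_sum1.
pose F := @sample_error R m p K n M N c pr.
have mean_le : prod_mean q F <= phi * r.
  have mean_ge0 : 0 <= prod_mean q F.
    by apply: sumr_ge0 => u _; apply: mulr_ge0; [exact: prod_mass_ge0|exact: normF_ge0].
  rewrite -ler_sqr ?nnegrE//; last exact: mulr_ge0 (ltW r_gt0).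
  apply: le_trans (sample_error_mean_le pr_ge0 c_gt0 pr_sum1 pr_supp) _.
  by apply: le_trans var_le _; rewrite exprMn r_sqr [leRHS]mulrA [leRHS]mulrAC.
set B := eta ^+ 2 / _ * _ * _.
have -> : [set u : draws n c | normF (M *m N - Cmx M pr u *m Dmx N pr u) ^+ 2 <= B]%SET
    = [set u | F (flatten_draws u) ^+ 2 <= B]%SET.
  by apply/setP => u; rewrite !inE /F sample_error_flatten.
rewrite (draws_prob_flatten pr (fun u => F u ^+ 2 <= B)).
(* It suffices to bound the mass of the complement by [delta]. *)
rewrite lerBlDr -(prod_mass_sum1 q_sum1) (bigID (fun u => F u ^+ 2 <= B))/= lerD2l.
apply: (@le_trans _ _ (\sum_(u | prod_mean q F + t <= F u) prod_mass q u)).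
  rewrite [leLHS]big_mkcond [leRHS]big_mkcond; apply: ler_sum => u _.
  case: ifPn => [|_]; last by case: ifP => // _; exact: prod_mass_ge0.
  (* A failing outcome has error above [eta * r], hence at least the mean plus [t]. *)
  rewrite -ltNge => B_lt; case: ifPn => // /negP[].
  apply: (@le_trans _ _ (eta * r)).
    by rewrite mulrDl lerD2r.
  rewrite -ler_sqr ?nnegrE ?normF_ge0//; last exact: mulr_ge0 (ltW r_gt0).
  apply: le_trans (ltW B_lt); apply: le_trans (scale_le _ (sqr_ge0 _)).
  by rewrite exprMn r_sqr mulrA mulrAC.
have d_gt0 : 0 < 2 * (W / (beta * ctot)) by rewrite mulr_gt0// divr_gt0.
have cardJ : #|{: {k : 'I_K & 'I_(c k)}}| = (\sum_k c k)%N := card_draw_slots c.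
apply: le_trans (mcdiarmid q_ge0 q_sum1 (sample_error_diff term_le) d_gt0 _ _) _.
- by rewrite cardJ -(ltr0n R).
- by rewrite mulr_ge0 ?sqrtr_ge0 ?ltW.
rewrite cardJ -/ctot t_sqr.
have -> : 8 / beta * L * (W ^+ 2 / (beta * ctot))
    / (2 * ctot * (2 * (W / (beta * ctot))) ^+ 2) = L.
  by field; rewrite !gt_eqF.
by rewrite expRN lnK ?posrE ?divr_gt0// div1r invrK.
Qed.
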